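(* Let $(M,g)$ be a pseudo-Riemannian manifold and let $J_+$, $J_-$ be two (integrable) complex structures on $M$ compatible with $g$. Let $F^{\pm}(X,Y)=g(J_{\pm}X,Y)$ be their fundamental $2$-forms and suppose that $d^+F^+=-d^-F^-$. Then $M$ admits a $J_+$-holomorphic Poisson structure $\Pi$ which vanishes if and only if $[J_+,J_-]=0$.
   Context: A complex structure $J$ is compatible with a pseudo-Riemannian metric $g$ if $g(JX,JY)=g(X,Y)$ for all tangent vectors $X,Y$. The operator $d^{\pm}$ is the imaginary part of the $\overline{\partial}$-operator of $J_{\pm}$, with $d^{\pm}F^{\pm}(X,Y,Z)=-dF^{\pm}(J_{\pm}X,J_{\pm}Y,J_{\pm}Z)$. The bracket $[J_+,J_-]=J_+J_--J_-J_+$ is the commutator of endomorphisms of $TM$. A $J_+$-holomorphic Poisson structure is a holomorphic section $\Pi$ of $\Lambda^2T^{(1,0)}M$ over the complex manifold $(M,J_+)$ whose Schouten-Nijenhuis bracket $[\Pi,\Pi]$ vanishes. *)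

(* Defs.v *)
(* MathComp-Analysis, plus the complex numbers R[i] of mathcomp-real-closed. *)
From HB Require Import structures.
From mathcomp Require Import all_boot all_order all_algebra.
From mathcomp Require Import all_classical all_reals all_analysis.
From mathcomp Require Import complex.
Set Implicit Arguments.
Unset Strict Implicit.
Unset Printing Implicit Defensive.
Import Order.TTheory GRing.Theory Num.Theory.
Import numFieldNormedType.Exports.
Local Open Scope classical_set_scope.
Local Open Scope ring_scope.

Definition partial (R : realType) (n : nat) (i : 'I_n) (f : 'cV[R]_n -> R)
    (x : 'cV[R]_n) : R :=
  'D_(delta_mx i 0) f x.

(* C^k on an open set; f and its partial derivatives are total functions whose
   values outside U are irrelevant. *)
Fixpoint Ck_on (R : realType) (n k : nat) (U : set 'cV[R]_n)
    (f : 'cV[R]_n -> R) : Prop :=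
  if k is k'.+1 then
    (forall x, U x -> differentiable f x) /\
    (forall i, Ck_on k' U (partial i f))
  else forall x, U x -> {for x, continuous f}.

Definition smooth_on (R : realType) (n : nat) (U : set 'cV[R]_n)
    (f : 'cV[R]_n -> R) : Prop :=
  forall k, Ck_on k U f.

Definition mx_smooth_on (R : realType) (n p q : nat) (U : set 'cV[R]_n)
    (f : 'cV[R]_n -> 'M[R]_(p, q)) : Prop :=
  forall i j, smooth_on U (fun x => f x i j).

(* Only the values of chart_map on chart_dom and of chart_inv on the image of
   chart_dom matter. *)
Record chart (R : realType) (n : nat) (M : topologicalType) := Chart {
  chart_dom : set M;
  chart_map : M -> 'cV[R]_n;
  chart_inv : 'cV[R]_n -> M;
  chart_dom_open : open chart_dom;
  chart_cod_open : open (chart_map @` chart_dom);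
  chart_mapK : forall p, chart_dom p -> chart_inv (chart_map p) = p;
  chart_map_continuous : {within chart_dom, continuous chart_map};
  chart_inv_continuous :
    {within chart_map @` chart_dom, continuous chart_inv} }.

Definition chart_cod (R : realType) (n : nat) (M : topologicalType)
    (c : chart R n M) : set 'cV[R]_n :=
  chart_map c @` chart_dom c.

Definition overlap (R : realType) (n : nat) (M : topologicalType)
    (c c' : chart R n M) : set 'cV[R]_n :=
  chart_map c @` (chart_dom c `&` chart_dom c').

Definition transition (R : realType) (n : nat) (M : topologicalType)
    (c c' : chart R n M) (x : 'cV[R]_n) : 'cV[R]_n :=
  chart_map c' (chart_inv c x).

Definition chart_compat (R : realType) (n : nat) (M : topologicalType)
    (c c' : chart R n M) : Prop :=
  mx_smooth_on (overlap c c') (transition c c') /\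
  mx_smooth_on (overlap c' c) (transition c' c).

Record smooth_manifold (R : realType) (n : nat) := SmoothManifold {
  carrier :> topologicalType;
  carrier_hausdorff : hausdorff_space carrier;
  carrier_second_countable : @second_countable carrier;
  atlas : set (chart R n carrier);
  atlas_cover : forall p, exists2 c, atlas c & chart_dom c p;
  atlas_compat : forall c c', atlas c -> atlas c' -> chart_compat c c';
  atlas_maximal : forall c,
    (forall c', atlas c' -> chart_compat c c') -> atlas c }.

Definition jacobian_mx (R : realType) (n : nat) (M : topologicalType)
    (c c' : chart R n M) (x : 'cV[R]_n) : 'M[R]_n :=
  \matrix_(i, j) partial j (fun y => transition c c' y i 0) x.

Definition bilin (R : realType) (n : nat) (G : 'M[R]_n) (u v : 'cV[R]_n) : R :=
  (u^T *m G *m v) 0 0.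

(* Tensor fields are given by their components with respect to the coordinate
   frames, one matrix-valued function on chart_cod c for each chart c of the
   maximal atlas, subject to the tensorial transformation law on overlaps.  Tangent
   vectors are coordinate columns; X is sent to A X by the change of chart with
   Jacobian matrix A. *)
Record pseudo_metric (R : realType) (n : nat) (M : smooth_manifold R n) :=
    PseudoMetric {
  metric_mx :> chart R n M -> 'cV[R]_n -> 'M[R]_n;
  metric_smooth : forall c, atlas c -> mx_smooth_on (chart_cod c) (metric_mx c);
  metric_change : forall c c', atlas c -> atlas c' ->
    forall x, overlap c c' x ->
    metric_mx c x = (jacobian_mx c c' x)^T
      *m metric_mx c' (transition c c' x) *m jacobian_mx c c' x;
  metric_sym : forall c x, atlas c -> chart_cod c x ->
    forall u v, bilin (metric_mx c x) u v = bilin (metric_mx c x) v u;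
  metric_nondegenerate : forall c x, atlas c -> chart_cod c x ->
    forall u, (forall v, bilin (metric_mx c x) u v = 0) -> u = 0 }.

Record almost_complex (R : realType) (n : nat) (M : smooth_manifold R n) :=
    AlmostComplex {
  ac_mx :> chart R n M -> 'cV[R]_n -> 'M[R]_n;
  ac_smooth : forall c, atlas c -> mx_smooth_on (chart_cod c) (ac_mx c);
  ac_change : forall c c', atlas c -> atlas c' ->
    forall x, overlap c c' x ->
    ac_mx c' (transition c c' x) *m jacobian_mx c c' x
      = jacobian_mx c c' x *m ac_mx c x;
  ac_square : forall c x, atlas c -> chart_cod c x ->
    ac_mx c x *m ac_mx c x = - 1%:M }.

(* R^(m + m) is identified with C^m by z_a = x_a + i y_a, where the x_a are the
   first m coordinates and the y_a the last m ones.  std_J sends d/dx_a to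
   d/dy_a and d/dy_a to - d/dx_a. *)
Definition std_J (R : realType) (m : nat) : 'M[R]_(m + m) :=
  block_mx 0 (- 1%:M) 1%:M 0.

Definition holo_chart (R : realType) (m : nat) (M : smooth_manifold R (m + m))
    (J : almost_complex M) (c : chart R (m + m) M) : Prop :=
  atlas c /\ forall x, chart_cod c x -> J c x = std_J R m.

(* Integrability in the sense of holomorphic coordinates: the holomorphic charts
   of J form a holomorphic atlas inducing J. *)
Record complex_structure (R : realType) (m : nat)
    (M : smooth_manifold R (m + m)) := ComplexStructure {
  cs_ac :> almost_complex M;
  cs_integrable : forall p, exists2 c, holo_chart cs_ac c & chart_dom c p }.

Definition compatible (R : realType) (n : nat) (M : smooth_manifold R n)
    (g : pseudo_metric M) (J : almost_complex M) : Prop :=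
  forall c x, atlas c -> chart_cod c x ->
  forall u v, bilin (g c x) (J c x *m u) (J c x *m v) = bilin (g c x) u v.

(* F(X, Y) = g(JX, Y) *)
Definition fundamental_form (R : realType) (n : nat) (M : smooth_manifold R n)
    (g : pseudo_metric M) (J : almost_complex M) (c : chart R n M)
    (x : 'cV[R]_n) : 'M[R]_n :=
  (J c x)^T *m g c x.

(* Exterior derivative of a 2-form, evaluated on the constant coordinate
   extensions of u, v, w (whose brackets vanish). *)
Definition ext_d (R : realType) (n : nat) (F : 'cV[R]_n -> 'M[R]_n)
    (x u v w : 'cV[R]_n) : R :=
  'D_u (fun y => bilin (F y) v w) x +
  'D_v (fun y => bilin (F y) w u) x +
  'D_w (fun y => bilin (F y) u v) x.

Definition twisted_d (R : realType) (n : nat) (J : 'cV[R]_n -> 'M[R]_n)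
    (F : 'cV[R]_n -> 'M[R]_n) (x u v w : 'cV[R]_n) : R :=
  - ext_d F x (J x *m u) (J x *m v) (J x *m w).

Definition cpartial (R : realType) (n : nat) (i : 'I_n)
    (f : 'cV[R]_n -> R[i]) (x : 'cV[R]_n) : R[i] :=
  (partial i (fun y => complex.Re (f y)) x +i*
   partial i (fun y => complex.Im (f y)) x)%C.

Definition dz (R : realType) (m : nat) (a : 'I_m)
    (f : 'cV[R]_(m + m) -> R[i]) (x : 'cV[R]_(m + m)) : R[i] :=
  (cpartial (lshift m a) f x - 'i%C * cpartial (rshift m a) f x) / 2%:R.

Definition dzbar (R : realType) (m : nat) (a : 'I_m)
    (f : 'cV[R]_(m + m) -> R[i]) (x : 'cV[R]_(m + m)) : R[i] :=
  (cpartial (lshift m a) f x + 'i%C * cpartial (rshift m a) f x) / 2%:R.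

Definition holomorphic_on (R : realType) (m : nat) (U : set 'cV[R]_(m + m))
    (f : 'cV[R]_(m + m) -> R[i]) : Prop :=
  forall x, U x ->
  [/\ differentiable (fun y => complex.Re (f y)) x,
      differentiable (fun y => complex.Im (f y)) x
    & forall a, dzbar a f x = 0].

Definition zcoord (R : realType) (m : nat) (a : 'I_m) (x : 'cV[R]_(m + m)) :
    R[i] :=
  (x (lshift m a) 0 +i* x (rshift m a) 0)%C.

Definition cjacobian_mx (R : realType) (m : nat) (M : topologicalType)
    (c c' : chart R (m + m) M) (x : 'cV[R]_(m + m)) : 'M[R[i]]_m :=
  \matrix_(a, b) dz b (fun y => zcoord a (transition c c' y)) x.

(* A holomorphic section of Lambda^2 T^(1,0) M, written in each holomorphic
   chart as 1/2 \sum_(a, b) P_ab d/dz_a /\ d/dz_b. *)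
Record holomorphic_bivector (R : realType) (m : nat)
    (M : smooth_manifold R (m + m)) (J : complex_structure M) :=
    HolomorphicBivector {
  biv_mx :> chart R (m + m) M -> 'cV[R]_(m + m) -> 'M[R[i]]_m;
  biv_skew : forall c x, holo_chart J c -> chart_cod c x ->
    (biv_mx c x)^T = - biv_mx c x;
  biv_holomorphic : forall c, holo_chart J c ->
    forall a b, holomorphic_on (chart_cod c) (fun x => biv_mx c x a b);
  biv_change : forall c c', holo_chart J c -> holo_chart J c' ->
    forall x, overlap c c' x ->
    biv_mx c' (transition c c' x)
      = cjacobian_mx c c' x *m biv_mx c x *m (cjacobian_mx c c' x)^T }.

(* Components of the Schouten-Nijenhuis bracket [P, Q] of holomorphic bivectors
   on C^m, up to an overall sign depending on conventions. *)
Definition schouten (R : realType) (m : nat)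
    (P Q : 'cV[R]_(m + m) -> 'M[R[i]]_m) (x : 'cV[R]_(m + m))
    (a b c : 'I_m) : R[i] :=
  let t i j k := \sum_l (P x l i * dz l (fun y => Q y j k) x +
                         Q x l i * dz l (fun y => P y j k) x) in
  t a b c + t b c a + t c a b.

Definition is_poisson (R : realType) (m : nat) (M : smooth_manifold R (m + m))
    (J : complex_structure M) (P : holomorphic_bivector J) : Prop :=
  forall c x, holo_chart J c -> chart_cod c x ->
  forall i j k, schouten (P c) (P c) x i j k = 0.

Definition vanishes_at (R : realType) (m : nat) (M : smooth_manifold R (m + m))
    (J : complex_structure M) (P : holomorphic_bivector J) (p : M) : Prop :=
  forall c, holo_chart J c -> chart_dom c p -> P c (chart_map c p) = 0.

Definition commutator_mx (R : realType) (n : nat) (M : smooth_manifold R n)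
    (J K : almost_complex M) (c : chart R n M) (x : 'cV[R]_n) : 'M[R]_n :=
  J c x *m K c x - K c x *m J c x.

(* Main.v *)
Require Import Defs.
From mathcomp Require Import all_boot all_order all_algebra.
From mathcomp Require Import all_classical all_reals all_analysis.
From mathcomp Require Import complex ring lra.
Set Implicit Arguments.
Unset Strict Implicit.
Unset Printing Implicit Defensive.
Import Order.TTheory GRing.Theory Num.Theory.
Import numFieldNormedType.Exports.
Local Open Scope classical_set_scope.
Local Open Scope ring_scope.

(**
  The bivector is Hitchin's Pi = [J+, J-] g^-1; since [J+, J-] anticommutes with J+,
  it is the real part of a (2,0)-bivector.  Put H = dF-(J- ., J- ., J- .), which is
  - dF+(J+ ., J+ ., J+ .) by hypothesis.  The metric connections with torsion H
  and - H preserve J- and J+ respectively; they have the same Christoffel symbols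
  up to exchanging the two lower indices.  In a J+-holomorphic chart J+ is
  constant, so that these symbols T(u; v, w) satisfy
  T(J+ u; v, w) = - T(u; v, J+ w), while the first derivatives of g and J- are
  expressed linearly in T.  Holomorphy of Pi is then immediate, and its Jacobi
  identity reduces to H being of type (2,1) + (1,2) for both complex structures.
  Since everything is of first order, the argument is linear algebra at a point,
  once the Nijenhuis tensor of J- is known to vanish in arbitrary coordinates.
*)

(** * First-order Hermitian geometry at a point *)

Section PointwiseAlgebra.
Variables (R : realFieldType) (V : zmodType).
Implicit Types (h k H : V -> V -> V -> R) (u v w : V).

(** Since [K (K u) = - u], normalising the identities below produces signs in each slot, and oddness
    is what extracts them. *)
Definition odd3 h :=
  [/\ forall u v w, h (- u) v w = - h u v w,
      forall u v w, h u (- v) w = - h u v w &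
      forall u v w, h u v (- w) = - h u v w].

(* [h u v w] and [k u v w] stand for the derivatives (D_u g)(v, w) and
   g((D_u K) v, w) in a chart; the four clauses are the symmetry of g, the
   derivatives of g(K v, w) + g(v, K w) = 0 and of K^2 = -1 and the vanishing of
   the Nijenhuis tensor of K. *)
Definition hermitian_1jet (K : V -> V) h k :=
  [/\ forall u v w, h u v w = h u w v,
      forall u v w, h u (K v) w + h u (K w) v + k u v w + k u w v = 0,
      forall u v w, k u (K v) w = k u v (K w) &
      forall u v w, k (K u) v w - k (K v) u w - k v u (K w) + k u v (K w) = 0].

(** This is the exterior derivative of F(v, w) = g(K v, w): the local [dF a b c] is the derivative
    of F(b, c) along a, by the product rule. *)
Definition d_fundamental (K : V -> V) h k u v w : R :=
  let dF a b c := h a (K b) c + k a b c in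
  dF u v w + dF v w u + dF w u v.

(* Lowered Christoffel symbols of the metric connection with torsion H. *)
Definition bismut h H u v w : R :=
  (h u v w + h v u w - h w u v + H u v w) / 2%:R.

Variables (K : V -> V) (h k H : V -> V -> V -> R).
Hypotheses (KN : forall u, K (- u) = - K u) (KK : forall u, K (K u) = - u).
Hypotheses (h_odd : odd3 h) (k_odd : odd3 k).
Hypothesis jet : hermitian_1jet K h k.
Hypothesis HE : forall u v w, H u v w = d_fundamental K h k (K u) (K v) (K w).

(* K is parallel for the connection with torsion H.  The identity is linear in
   the values of h and k, and follows from the seven instances given to [lra]. *)
Lemma hermitian_1jet_parallel u v w :
  k u v w = - bismut h H u (K v) w - bismut h H u v (K w).
Proof.
case: h_odd k_odd => [h1 h2 h3] [k1 k2 k3]; case: jet => hs sk kK N.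
move: (sk (K v) (K u) w) (sk (K u) v (K w)) (N (K u) (K w) (K v))
  (kK u (K v) w) (N (K u) (K v) (K w)) (sk u (K v) (K w)) (sk v (K u) (K w)).
rewrite /bismut !HE /d_fundamental !KK !(KN, h1, h2, h3, k1, k2, k3, KK).
rewrite ?(hs _ v u) ?(hs _ v (K u)) ?(hs _ (K v) u) ?(hs _ (K v) (K u)).
rewrite ?(hs _ w u) ?(hs _ w (K u)) ?(hs _ (K w) u) ?(hs _ (K w) (K u)).
rewrite ?(hs _ w v) ?(hs _ w (K v)) ?(hs _ (K w) v) ?(hs _ (K w) (K v)).
move=> *; lra.
Qed.

(** On a (3,0) or (0,3) part of [H] the left side would be - 3 [H], on a (2,1) or (1,2) part it is
    [H]; the identity thus says that [H] has type (2,1) + (1,2). As above, it is a linear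
    combination of the listed instances of the jet relations. *)
Lemma hermitian_1jet_type u v w :
  H (K u) (K v) w + H (K u) v (K w) + H u (K v) (K w) = H u v w.
Proof.
case: h_odd k_odd => [h1 h2 h3] [k1 k2 k3]; case: jet => hs sk kK N.
move: (sk (K w) u v) (kK u w v) (N v w u) (kK v (K u) (K w)) (sk v u (K w))
  (sk u v (K w)) (N u w v) (kK (K w) u (K v)) (N (K u) (K v) w)
  (sk (K u) v w) (sk w (K u) v) (sk (K v) (K u) (K w)).
rewrite !HE /d_fundamental !(KN, h1, h2, h3, k1, k2, k3, KK).
rewrite ?(hs _ v u) ?(hs _ v (K u)) ?(hs _ (K v) u) ?(hs _ (K v) (K u)).
rewrite ?(hs _ w u) ?(hs _ w (K u)) ?(hs _ (K w) u) ?(hs _ (K w) (K u)).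
rewrite ?(hs _ w v) ?(hs _ w (K v)) ?(hs _ (K w) v) ?(hs _ (K w) (K v)).
move=> *; lra.
Qed.

(** Comes from the second jet clause, the derivative of the skewness of F. With the evident cyclic
    symmetry it makes dF totally alternating. *)
Lemma d_fundamental_alt u v w : d_fundamental K h k v u w = - d_fundamental K h k u v w.
Proof.
by case: jet => _ sk _ _; rewrite /d_fundamental; move: (sk u v w) (sk v w u) (sk w u v);
  move=> *; lra.
Qed.

(** The connection is metric: [H] is skew in its last two arguments and drops out of the sum. *)
Lemma bismut_sym u v w : h u v w = bismut h H u v w + bismut h H u w v.
Proof.
case: jet => hs _ _ _.
rewrite /bismut !HE.
rewrite (hs u w v).
move: (d_fundamental_alt (K u) (K v) (K w)) (d_fundamental_alt (K u) (K w) (K v)).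
rewrite /d_fundamental; move=> *; lra.
Qed.

Lemma bismut_torsion u v w :
  bismut h H u v w - bismut h H v u w = H u v w.
Proof.
case: jet => hs _ _ _.
rewrite /bismut !HE (d_fundamental_alt (K u) (K v)) (hs w v u); lra.
Qed.
End PointwiseAlgebra.

(** * Holomorphy and Jacobi identity of the bivector at a point *)

Section Hitchin.
Variables (R : realFieldType) (V : zmodType) (J K : V -> V).
Variables (h k H : V -> V -> V -> R).
Hypotheses (JN : forall u, J (- u) = - J u) (JJ : forall u, J (J u) = - u).
Hypotheses (KN : forall u, K (- u) = - K u) (KK : forall u, K (K u) = - u).
Hypotheses (h_odd : odd3 h) (k_odd : odd3 k).
Hypotheses (hB : forall u1 u2 v w, h (u1 - u2) v w = h u1 v w - h u2 v w).
Hypotheses (kB : forall u1 u2 v w, k (u1 - u2) v w = k u1 v w - k u2 v w).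
Hypothesis jetJ : hermitian_1jet J h (fun _ _ _ => 0).
Hypothesis jetK : hermitian_1jet K h k.
Hypothesis HJ : forall u v w,
  H u v w = - d_fundamental J h (fun _ _ _ => 0) (J u) (J v) (J w).
Hypothesis HK : forall u v w, H u v w = d_fundamental K h k (K u) (K v) (K w).

Let T := bismut h H.

Let zero_odd : odd3 (fun _ _ _ : V => 0 : R).
Proof. by split=> *; rewrite oppr0. Qed.

Let HNJ u v w : - H u v w = d_fundamental J h (fun _ _ _ => 0) (J u) (J v) (J w).
Proof. by rewrite HJ opprK. Qed.

Let bismut_flip u v w : bismut h (fun a b c => - H a b c) u v w = T v u w.
Proof.
have := bismut_torsion jetK HK u v w.
by case: jetK => hs _ _ _; rewrite /T /bismut (hs w v u); move=> *; lra.
Qed.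

(* J is parallel for the connection with torsion - H, that is, for [T] with its
   first two arguments exchanged. *)
Let TJ u v w : T (J u) v w = - T u v (J w).
Proof.
have := hermitian_1jet_parallel JN JJ h_odd zero_odd jetJ HNJ v u w.
by rewrite !bismut_flip; move=> *; lra.
Qed.

Let hT u v w : h u v w = T u v w + T u w v := bismut_sym jetK HK u v w.

Let kT u v w : k u v w = - T u (K v) w - T u v (K w) :=
  hermitian_1jet_parallel KN KK h_odd k_odd jetK HK u v w.

Let hJ u v w : h u (J v) w = - h u v (J w).
Proof. by case: jetJ => hs sk _ _; move: (sk u v w); rewrite (hs u (J w)); move=> *; lra. Qed.

(* The derivative of the bivector [J, K] g^-1 in the direction u, evaluated on
   the covectors g a and g b. *)
Definition hitchin_deriv u a b : R :=
  h u a (J (K b)) - h u a (K (J b)) - k u a (J b) - k u (J a) b.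

Let T_odd : odd3 T.
Proof.
case: h_odd k_odd => [h1 h2 h3] [k1 k2 k3].
by split=> u v w; rewrite /T /bismut !HK /d_fundamental !(KN, h1, h2, h3, k1, k2, k3); lra.
Qed.

(** After [hT] and [kT], the relation [hJ] cancels every symbol whose second argument does not start
    with [K]. The remaining expression is visibly skew in [a] and [b]. *)
Let hitchin_derivE u a b : hitchin_deriv u a b =
  T u (K a) (J b) + T u (K (J a)) b - T u (K b) (J a) - T u (K (J b)) a.
Proof.
rewrite /hitchin_deriv; move: (hJ u a (K b)); rewrite !hT !kT; move=> *; lra.
Qed.

(** These are the Cauchy-Riemann equations. [TJ] carries [J] from the first argument of each symbol
    to its last, after which the four terms match one by one. *)
Lemma hitchin_deriv_holomorphic u a b :
  hitchin_deriv (J u) a b = - hitchin_deriv u (J a) b.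
Proof.
case: T_odd => [T1 T2 T3].
by rewrite !hitchin_derivE !TJ !(JJ, KN, T1, T2, T3); lra.
Qed.

(** The direction [J (K u) - K (J u)] is the bivector applied to the covector g u, so the cyclic sum
    is the Jacobi identity. The Christoffel symbols cancel in pairs up to torsion, and the torsion
    terms cancel by type. *)
Lemma hitchin_deriv_jacobi a b c :
  let q u := hitchin_deriv (J (K u) - K (J u)) in
  q a b c + q b c a + q c a b = 0.
Proof.
case: T_odd => [T1 T2 T3] /=.
have qB u1 u2 v w :
    hitchin_deriv (u1 - u2) v w = hitchin_deriv u1 v w - hitchin_deriv u2 v w.
  by rewrite /hitchin_deriv !hB !kB; lra.
have skew x y z : T x y z = T y x z + H x y z.
  by move: (bismut_torsion jetK HK x y z); rewrite -/T; move=> *; lra.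
have HC x y z : H x y z = H y z x by rewrite !HK /d_fundamental; lra.
have HA x y z : H x y z = - H y x z.
  by rewrite !HK (d_fundamental_alt jetK (K y)).
have HJtype := hermitian_1jet_type JN JJ h_odd zero_odd jetJ HNJ a b c.
have HKtype x y z :
    H (K x) (K y) z + H (K y) (K z) x + H (K z) (K x) y = H x y z.
  rewrite -[RHS](hermitian_1jet_type KN KK h_odd k_odd jetK HK).
  by rewrite (HC x (K y)) (HC (K z)) (HC (K x) y); lra.
rewrite !qB !hitchin_derivE !TJ !(JJ, KN, T1, T2, T3).
(* [TJ] has brought every symbol to the form [T (K _) (K _) _]. Two terms of the cyclic sum that
   differ by exchanging the first two arguments have opposite signs, so [skew] reduces each such
   pair to a value of [H]. *)
rewrite (skew (K b) (K a)) (skew (K c) (K b)) (skew (K a) (K c)).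
rewrite (skew (K (J b)) (K (J a))) (skew (K (J c)) (K (J b))) (skew (K (J a)) (K (J c))).
rewrite (skew (K (J b)) (K a)) (skew (K (J c)) (K b)) (skew (K (J a)) (K c)).
rewrite (skew (K (J b)) (K c)) (skew (K (J c)) (K a)) (skew (K (J a)) (K b)).
(* The type of [H] for [K], at the four triples with an even number of [J], removes every [K]. What
   remains is the type condition for [J]. *)
move: HJtype (HKtype a b c) (HKtype a (J b) (J c)) (HKtype (J a) b (J c))
  (HKtype (J a) (J b) c).
rewrite (HA (K c) (K b)) (HA (K b) (K a)) (HA (K a) (K c)).
rewrite (HA (K (J b)) (K (J a))) (HA (K (J c)) (K (J b))) (HA (K (J a)) (K (J c))).
rewrite ?(HA (K (J b)) (K a)) ?(HA (K (J c)) (K b)) ?(HA (K (J a)) (K c)).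
move=> *; lra.
Qed.
End Hitchin.

(** * Symmetry of mixed second derivatives *)

Section MixedDerivatives.
Variables (R : realType) (V : normedModType R).
Implicit Types (f : V -> R) (x u v : V) (s t : R).

Lemma is_derive_line f x u s : derivable f (x + s *: u) u ->
  is_derive s 1 (fun r => f (x + r *: u)) ('D_u f (x + s *: u)).
Proof.
have E h : f (x + (h *: 1 + s) *: u) = f (h *: u + (x + s *: u)).
  by rewrite [h *: 1]mulr1 scalerDl addrCA.
move=> df; apply: DeriveDef.
  by move: df; rewrite /derivable /=; under eq_fun do rewrite -E.
by rewrite /derive /=; under eq_fun do rewrite E.
Qed.

Lemma MVT_line f x u t : 0 < t ->
  (forall s, 0 <= s <= t -> differentiable f (x + s *: u)) ->
  exists2 s, 0 <= s <= t & f (x + t *: u) - f x = 'D_u f (x + s *: u) * t.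
Proof.
move=> t0 df.
have dline s : 0 <= s <= t ->
    is_derive s 1 (fun r => f (x + r *: u)) ('D_u f (x + s *: u)).
  by move=> st; apply/is_derive_line/diff_derivable/df.
have [||s st E] := @MVT R (fun r => f (x + r *: u))
    (fun r => 'D_u f (x + r *: u)) 0 t t0.
- by move=> s; rewrite in_itv /= => /andP[s0 st]; apply: dline; rewrite !ltW.
- apply: derivable_within_continuous => s; rewrite in_itv /= => st.
  by have [] := dline s st.
exists s; first by move: st; rewrite in_itv /= => /andP[? ?]; rewrite !ltW.
by move: E; rewrite scale0r addr0 subr0.
Qed.

(** The mean value theorem along [u] is applied to the increment [g] of [f] along [t *: v], and then
    along [v] to the derivative of [f] in direction [u]. *)
Lemma MVT_mixed f x u v t : 0 < t ->
  (forall r s, 0 <= r <= t -> 0 <= s <= t ->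
     differentiable f (x + r *: u + s *: v) /\
     differentiable ('D_u f) (x + r *: u + s *: v)) ->
  exists r s, [/\ 0 <= r <= t, 0 <= s <= t &
    f (x + t *: u + t *: v) - f (x + t *: u) - f (x + t *: v) + f x =
    'D_v ('D_u f) (x + r *: u + s *: v) * t * t].
Proof.
move=> t0 df.
have tt : 0 <= t <= t by rewrite lexx ltW.
have z0 : 0 <= (0 : R) <= t by rewrite lexx ltW.
pose g y := f (y + t *: v) - f y.
have dshift (h : V -> R) (a y : V) :
    differentiable h (y + a) -> differentiable (fun z => h (z + a)) y.
  by by move=> dh; apply: (@differentiable_comp _ _ _ _ (fun z => z + a) h).
have Dshift (h : V -> R) (a y w : V) :
    'D_w (fun z => h (z + a)) y = 'D_w h (y + a).
  by rewrite /derive /=; under eq_fun do rewrite -addrA.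
have df0 r : 0 <= r <= t -> differentiable f (x + r *: u).
  by move=> rt; have [] := df r 0 rt z0; rewrite scale0r addr0.
have dft r : 0 <= r <= t -> differentiable (fun y => f (y + t *: v)) (x + r *: u).
  by move=> rt; apply: dshift; have [] := df r t rt tt.
have [|r rt Er] := @MVT_line g x u t t0.
  by move=> r rt; apply: differentiableB; [exact: dft|exact: df0].
have [|s st Es] := @MVT_line ('D_u f) (x + r *: u) v t t0.
  by move=> s st; have [] := df r s rt st.
exists r, s; split=> //.
rewrite -Es.
suff <- : 'D_u g (x + r *: u) = 'D_u f (x + r *: u + t *: v) - 'D_u f (x + r *: u).
  by rewrite -Er /g; ring.
rewrite -(Dshift f (t *: v)).
have d1 : derivable (fun y => f (y + t *: v)) (x + r *: u) u.
  by apply: diff_derivable; exact: dft.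
have d0 : derivable f (x + r *: u) u by apply: diff_derivable; exact: df0.
exact: (deriveB d1 d0).
Qed.

(** The second difference over a parallelogram is symmetric in [u] and [v], and [MVT_mixed] makes it
    a value of either mixed derivative near [x]. If the two differed at [x], continuity would keep
    each within half of the gap [e + e]. *)
Lemma derive_comm f u v x :
  (\forall y \near x, differentiable f y) ->
  (\forall y \near x, differentiable ('D_u f) y) ->
  (\forall y \near x, differentiable ('D_v f) y) ->
  {for x, continuous ('D_v ('D_u f))} -> {for x, continuous ('D_u ('D_v f))} ->
  'D_v ('D_u f) x = 'D_u ('D_v f) x.
Proof.
move=> df du dv cvu cuv.
apply/eqP/negPn/negP => neq.
pose e := `|'D_v ('D_u f) x - 'D_u ('D_v f) x| / 2.
have e0 : 0 < e by rewrite divr_gt0// normr_gt0 subr_eq0.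
have c1 : \forall y \near x, `|'D_v ('D_u f) x - 'D_v ('D_u f) y| < e.
  by move/cvgrPdist_lt : cvu => /(_ _ e0).
have c2 : \forall y \near x, `|'D_u ('D_v f) x - 'D_u ('D_v f) y| < e.
  by move/cvgrPdist_lt : cuv => /(_ _ e0).
have near_x : nbhs x
    ([set y | differentiable f y]
    `&` ([set y | differentiable ('D_u f) y] `&` [set y | differentiable ('D_v f) y])
    `&` ([set y | `|'D_v ('D_u f) x - 'D_v ('D_u f) y| < e]
    `&` [set y | `|'D_u ('D_v f) x - 'D_u ('D_v f) y| < e])).
  apply: filterI; apply: filterI; [exact: df| |exact: c1|exact: c2].
  by apply: filterI; [exact: du|exact: dv].
have [d /= d0 dP] := (nbhs_ballP _ _).1 near_x.
(* With this [t] the whole parallelogram lies within d / 2 of [x]; the summand 1 keeps the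
   denominator positive when [u] and [v] vanish. *)
pose t := d / (2 * (`|u| + `|v| + 1)).
have n0 : 0 < `|u| + `|v| + 1 by rewrite ltr_wpDl// addr_ge0.
have t0 : 0 < t by rewrite divr_gt0// mulr_gt0.
have close r s : 0 <= r <= t -> 0 <= s <= t -> ball x d (x + r *: u + s *: v).
  move=> /andP[r0 rt] /andP[s0 st]; rewrite -ball_normE /=.
  rewrite -addrA opprD addNKr normrN (le_lt_trans (ler_normD _ _))//.
  rewrite !normrZ !ger0_norm//.
  have : r * `|u| + s * `|v| <= t * (`|u| + `|v| + 1).
    apply: (@le_trans _ _ (t * `|u| + t * `|v|)).
      by apply: lerD; apply: ler_wpM2r.
    by rewrite -mulrDr [leRHS]mulrDr mulr1 lerDl ltW.
  move=> /le_lt_trans; apply.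
  rewrite /t invfM mulrA mulfVK ?gt_eqF//.
  by rewrite ltr_pdivrMr// ltr_pMr// ltr1n.
have [|r [s [rt st E1]]] := @MVT_mixed f x u v t t0.
  by move=> r s rt st; have [[? []]] := dP _ (close r s rt st).
have [|s' [r' [st' rt' E2]]] := @MVT_mixed f x v u t t0.
  by move=> a b at' bt'; rewrite addrAC; have [[? []]] := dP _ (close b a bt' at').
have [_ [C1 _]] := dP _ (close r s rt st).
have [_ [_ C2]] := dP _ (close r' s' rt' st').
have EE : 'D_v ('D_u f) (x + r *: u + s *: v) =
          'D_u ('D_v f) (x + r' *: u + s' *: v).
  have key (p q a a' b c k : R) : a' = a ->
      a - b - c + k = p * t * t -> a' - c - b + k = q * t * t -> p = q.
    move=> -> p1 p2; have tn0 : t != 0 by rewrite gt_eqF.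
    by apply: (mulIf tn0); apply: (mulIf tn0); rewrite -p1 -p2; congr (_ + _); rewrite addrAC.
  apply: etrans (congr1 ('D_u ('D_v f)) (addrAC _ _ _)).
  exact: key (congr1 f (addrAC _ _ _)) E1 E2.
have : `|'D_v ('D_u f) x - 'D_u ('D_v f) x| < e + e.
  apply: le_lt_trans (ler_distD ('D_v ('D_u f) (x + r *: u + s *: v)) _ _) _.
  by apply: ltrD; [exact: C1|rewrite EE distrC; exact: C2].
by rewrite -splitr ltxx.
Qed.
End MixedDerivatives.

(** * Differential calculus of matrix-valued maps, entry by entry *)

Section MatrixCalculus.
Variables (R : realType) (V : normedModType R).
Implicit Types (x u v : V).

Definition mx_differentiable p q (f : V -> 'M[R]_(p, q)) x :=
  forall i j, differentiable (fun y => f y i j) x.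

Lemma mx_differentiable_derivable p q (f : V -> 'M[R]_(p, q)) x u :
  mx_differentiable f x -> derivable f x u.
Proof. by move=> df; apply/derivable_mxP => i j; apply: diff_derivable; exact: df. Qed.

Lemma derive_mxE p q (f : V -> 'M[R]_(p, q)) x u i j : mx_differentiable f x ->
  ('D_u f x) i j = 'D_u (fun y => f y i j) x.
Proof. by move=> df; rewrite derive_mx ?mxE//; exact: mx_differentiable_derivable. Qed.

Lemma derive_mx_linear p q (f : V -> 'M[R]_(p, q)) x : mx_differentiable f x ->
  linear (fun u => 'D_u f x).
Proof.
move=> df a u v; apply/matrixP => i j; rewrite !mxE !derive_mxE// !deriveE; try exact: df.
by rewrite linearP.
Qed.

Lemma mx_differentiable_cst p q (A : 'M[R]_(p, q)) x : mx_differentiable (cst A) x.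
Proof. by move=> i j; exact: differentiable_cst. Qed.

Lemma mx_differentiableB p q (f g : V -> 'M[R]_(p, q)) x :
  mx_differentiable f x -> mx_differentiable g x ->
  mx_differentiable (fun y => f y - g y) x.
Proof.
move=> df dg i j; under eq_fun do rewrite !mxE.
exact: (differentiableB (df i j) (dg i j)).
Qed.

Lemma derive_mxB p q (f g : V -> 'M[R]_(p, q)) x u :
  mx_differentiable f x -> mx_differentiable g x ->
  'D_u (fun y => f y - g y) x = 'D_u f x - 'D_u g x.
Proof.
move=> df dg.
exact: (deriveB (@mx_differentiable_derivable _ _ _ _ u df)
  (@mx_differentiable_derivable _ _ _ _ u dg)).
Qed.

Lemma differentiable_bigsum (I : finType) (f : I -> V -> R) x :
  (forall i, differentiable (f i) x) ->
  differentiable (fun y => \sum_i f i y) x.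
Proof.
move=> df.
rewrite (_ : (fun _ => _) = \sum_i f i); last by apply/funext => y; rewrite fct_sumE.
by elim/big_ind : _ => // g h ? ?; exact: differentiableD.
Qed.

Lemma differentiable_bigprod (I : finType) (f : I -> V -> R) x :
  (forall i, differentiable (f i) x) ->
  differentiable (fun y => \prod_i f i y) x.
Proof.
move=> df.
rewrite (_ : (fun _ => _) = \prod_i f i); last by apply/funext => y; rewrite fct_prodE.
by elim/big_ind : _ => // g h ? ?; exact: differentiableM.
Qed.

Lemma mx_differentiableM p q r (f : V -> 'M[R]_(p, q)) (g : V -> 'M[R]_(q, r)) x :
  mx_differentiable f x -> mx_differentiable g x ->
  mx_differentiable (fun y => f y *m g y) x.
Proof.
move=> df dg i j; under eq_fun do rewrite mxE.
by apply: differentiable_bigsum => k; exact: (differentiableM (df i k) (dg k j)).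
Qed.

Lemma derive_mulmx p q r (f : V -> 'M[R]_(p, q)) (g : V -> 'M[R]_(q, r)) x u :
  mx_differentiable f x -> mx_differentiable g x ->
  'D_u (fun y => f y *m g y) x = 'D_u f x *m g x + f x *m 'D_u g x.
Proof.
move=> df dg; apply/matrixP => i j.
rewrite derive_mxE; last exact: mx_differentiableM.
under eq_fun do rewrite mxE.
rewrite !mxE -big_split /=.
rewrite (_ : (fun _ => _) = \sum_k (fun y => f y i k * g y k j)); last first.
  by apply/funext => y; rewrite fct_sumE.
have dfg k : derivable (fun y => f y i k * g y k j) x u.
  by apply: diff_derivable; exact: (differentiableM (df i k) (dg k j)).
rewrite derive_sum//; apply: eq_bigr => k _.
have d1 : derivable (fun y => f y i k) x u by apply: diff_derivable; exact: df.
have d2 : derivable (fun y => g y k j) x u by apply: diff_derivable; exact: dg.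
rewrite (deriveM d1 d2) !derive_mxE// addrC /GRing.scale /=. by congr (_ + _); exact: mulrC.
Qed.

Lemma mx_differentiable_tr p q (f : V -> 'M[R]_(p, q)) x :
  mx_differentiable f x -> mx_differentiable (fun y => (f y)^T) x.
Proof. by move=> df i j; under eq_fun do rewrite mxE; exact: df. Qed.

Lemma derive_trmx p q (f : V -> 'M[R]_(p, q)) x u : mx_differentiable f x ->
  'D_u (fun y => (f y)^T) x = ('D_u f x)^T.
Proof.
move=> df; apply/matrixP => i j.
rewrite derive_mxE; last exact: mx_differentiable_tr.
by rewrite mxE derive_mxE//; under eq_fun do rewrite mxE.
Qed.

Lemma differentiable_det p (f : V -> 'M[R]_p) x : mx_differentiable f x ->
  differentiable (fun y => \det (f y)) x.
Proof.
move=> df; apply: differentiable_bigsum => s.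
apply: (@differentiableM _ _ (cst _)); first exact: differentiable_cst.
by apply: differentiable_bigprod => i; exact: df.
Qed.

Lemma mx_differentiable_adj p (f : V -> 'M[R]_p) x :
  mx_differentiable f x -> mx_differentiable (fun y => \adj (f y)) x.
Proof.
move=> df i j; under eq_fun do rewrite mxE.
apply: (@differentiableM _ _ (cst _)); first exact: differentiable_cst.
by apply: differentiable_det => k l; under eq_fun do rewrite !mxE; exact: df.
Qed.

Lemma mx_differentiable_det_adj p (f : V -> 'M[R]_p) x :
  mx_differentiable f x -> \det (f x) != 0 ->
  mx_differentiable (fun y => (\det (f y))^-1 *: \adj (f y)) x.
Proof.
move=> df f0 i j; under eq_fun do rewrite mxE.
apply: (@differentiableM _ _ (fun y => (\det (f y))^-1)); last exact: mx_differentiable_adj.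
by apply: differentiableV => //; exact: differentiable_det.
Qed.
End MatrixCalculus.

(** * Partial derivatives of smooth functions and the chain rule *)

Section CoordinateDerivatives.
Variables (R : realType) (n : nat).
Implicit Types (x u : 'cV[R]_n) (U : set 'cV[R]_n).

Lemma smooth_on_differentiable U (f : 'cV[R]_n -> R) x :
  smooth_on U f -> U x -> differentiable f x.
Proof. by move=> /(_ 1%N) [df _]; exact: df. Qed.

Lemma smooth_on_partial U (f : 'cV[R]_n -> R) i :
  smooth_on U f -> smooth_on U (partial i f).
Proof. by move=> sf k; have [_] := sf k.+1; exact. Qed.

Lemma mx_smooth_on_differentiable p q U (f : 'cV[R]_n -> 'M[R]_(p, q)) x :
  mx_smooth_on U f -> U x -> mx_differentiable f x.
Proof. by move=> sf Ux i j; exact: smooth_on_differentiable (sf i j) Ux. Qed.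

Lemma derive_partial (f : 'cV[R]_n -> R) x u : differentiable f x ->
  'D_u f x = \sum_i partial i f x * u i 0.
Proof.
move=> df; rewrite deriveE// [in LHS](matrix_sum_delta u) linear_sum.
apply: eq_bigr => i _; rewrite big_ord1 linearZ /partial deriveE//.
exact: mulrC.
Qed.

Lemma smooth_on_derive_comm U (f : 'cV[R]_n -> R) x i j :
  open U -> smooth_on U f -> U x ->
  partial i (partial j f) x = partial j (partial i f) x.
Proof.
move=> oU sf Ux.
have nU : nbhs x U by exact: open_nbhs_nbhs.
have near_diff (h : 'cV[R]_n -> R) :
    smooth_on U h -> \forall y \near x, differentiable h y.
  by move=> sh; apply: filterS nU => y; exact: smooth_on_differentiable.
apply: derive_comm.
- exact: near_diff.
- exact: (near_diff _ (smooth_on_partial j sf)).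
- exact: (near_diff _ (smooth_on_partial i sf)).
(* Order 0 of smoothness is continuity, here of the second partial derivatives. *)
- exact: (smooth_on_partial i (smooth_on_partial j sf)) 0%N _ Ux.
- exact: (smooth_on_partial j (smooth_on_partial i sf)) 0%N _ Ux.
Qed.

Lemma mx_differentiable_differentiable (V : normedModType R) p (f : V -> 'cV[R]_p) (x : V) :
  mx_differentiable f x -> differentiable f x.
Proof.
move=> df.
rewrite (_ : f = \sum_i (fun y => f y i 0 *: delta_mx i 0)).
  apply: differentiable_sum => i.
  exact: (@differentiableZl _ _ _ (fun y => f y i 0)).
apply/funext => y; rewrite fct_sumE [LHS]matrix_sum_delta.
by apply: eq_bigr => i _; rewrite big_ord1.
Qed.

Lemma derive_comp (V W X : normedModType R) (f : W -> X) (g : V -> W) (x u : V) :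
  differentiable g x -> differentiable f (g x) ->
  'D_u (f \o g) x = 'D_('D_u g x) f (g x).
Proof.
move=> dg df; rewrite !deriveE//; last exact: differentiable_comp.
by rewrite diff_comp.
Qed.
End CoordinateDerivatives.

(** * Charts, transition maps and their Jacobians *)

Section Charts.
Variables (R : realType) (n : nat) (M : topologicalType).
Implicit Types (c : chart R n M) (x u : 'cV[R]_n).

(** Written as a preimage under [chart_inv c], the overlap is open by continuity of the inverse
    chart. *)
Lemma overlapE c c' :
  overlap c c' = chart_cod c `&` chart_inv c @^-1` chart_dom c'.
Proof.
apply/seteqP; split=> x /=.
  by move=> [p [cp cp'] <-]; split; [exists p|rewrite /= chart_mapK].
by move=> [[p cp <-]]; rewrite /= chart_mapK// => cp'; exists p.
Qed.

Lemma overlap_open c c' : open (overlap c c').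
Proof.
rewrite overlapE.
have oU : open (chart_cod c) by exact: chart_cod_open.
move: (@chart_inv_continuous _ _ _ c); rewrite continuous_open_subspace//.
by move=> /(continuous_inP _ oU); apply; exact: (@chart_dom_open _ _ _ c').
Qed.

Lemma overlap_transition c c' x :
  overlap c c' x -> overlap c' c (transition c c' x).
Proof.
by move=> [p [cp cp'] <-]; rewrite /transition chart_mapK//; exists p.
Qed.

Lemma overlap_cod c c' x : overlap c c' x -> chart_cod c x.
Proof. by move=> [p [cp _] <-]; exists p. Qed.

Lemma transitionK c c' x : overlap c c' x -> transition c' c (transition c c' x) = x.
Proof. by move=> [p [cp cp'] <-]; rewrite /transition !chart_mapK. Qed.
End Charts.

Section Transitions.
Variables (R : realType) (n : nat) (M : smooth_manifold R n).
Variables (c c' : chart R n M).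
Hypotheses (ac : atlas c) (ac' : atlas c').
Implicit Types (x u v : 'cV[R]_n).

Lemma near_overlap x : overlap c c' x -> \forall y \near x, overlap c c' y.
Proof. by move=> cx; apply: open_nbhs_nbhs; split=> //; exact: overlap_open. Qed.

Lemma transition_smooth : mx_smooth_on (overlap c c') (transition c c').
Proof. by have [] := atlas_compat ac ac'. Qed.

Lemma transition_differentiable x :
  overlap c c' x -> mx_differentiable (transition c c') x.
Proof. exact: mx_smooth_on_differentiable transition_smooth. Qed.

Lemma jacobian_mxE x u : overlap c c' x ->
  jacobian_mx c c' x *m u = 'D_u (transition c c') x.
Proof.
move=> cx; apply/matrixP => i j; rewrite (ord1 j) mxE derive_mxE; last first.
  exact: transition_differentiable.
rewrite derive_partial; last exact: transition_differentiable.
by apply: eq_bigr => k _; rewrite mxE.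
Qed.

Lemma jacobian_mx_differentiable x :
  overlap c c' x -> mx_differentiable (jacobian_mx c c') x.
Proof.
move=> cx i j; under eq_fun do rewrite mxE.
exact: smooth_on_differentiable (smooth_on_partial _ (transition_smooth i 0)) cx.
Qed.

(** Both sides are the second derivative of the transition map in the directions [u] and [v]. *)
Lemma derive_jacobian_sym x u v : overlap c c' x ->
  'D_u (jacobian_mx c c') x *m v = 'D_v (jacobian_mx c c') x *m u.
Proof.
move=> cx; apply/matrixP => i o; rewrite !mxE.
have E w j : 'D_w (jacobian_mx c c') x i j =
    \sum_k partial k (partial j (fun y => transition c c' y i 0)) x * w k 0.
  rewrite derive_mxE; last exact: jacobian_mx_differentiable.
  under eq_fun do rewrite mxE.
  apply: derive_partial.
  exact: smooth_on_differentiable (smooth_on_partial _ (transition_smooth i 0)) cx.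
rewrite (ord1 o); under eq_bigr do rewrite E mulr_suml.
rewrite exchange_big; apply: eq_bigr => k _ /=.
rewrite E mulr_suml; apply: eq_bigr => j _.
rewrite (smooth_on_derive_comm j k (@overlap_open _ _ _ c c')
  (transition_smooth i 0) cx).
exact: mulrAC.
Qed.
End Transitions.

(** The chain rule, column by column: the composite of the two transitions is the identity near
    [x]. *)
Lemma jacobian_mxK (R : realType) (n : nat) (M : smooth_manifold R n)
    (c c' : chart R n M) x : atlas c -> atlas c' -> overlap c c' x ->
  jacobian_mx c' c (transition c c' x) *m jacobian_mx c c' x = 1%:M.
Proof.
move=> ac ac' cx; have cx' := overlap_transition cx.
apply/matrixP => i j.
transitivity ((jacobian_mx c' c (transition c c' x) *m jacobian_mx c c' x
               *m (delta_mx j 0 : 'cV_n)) i 0).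
  by rewrite -colE [RHS]mxE.
rewrite -mulmxA jacobian_mxE// jacobian_mxE// -derive_comp; last 2 first.
- exact/mx_differentiable_differentiable/transition_differentiable.
- exact/mx_differentiable_differentiable/transition_differentiable.
rewrite (@near_eq_derive _ _ _ _ id) ?derive_id ?mxE ?andbT//.
by apply: filterS (near_overlap cx) => y; exact: transitionK.
Qed.

(** * Bilinear forms in matrix notation *)

Section BilinearForms.
Variables (R : realType) (n : nat).
Implicit Types (G H A : 'M[R]_n) (u v : 'cV[R]_n).

Lemma bilin_delta G i j : bilin G (delta_mx i 0) (delta_mx j 0) = G i j.
Proof. by rewrite /bilin trmx_delta -mulmxA -colE -rowE !mxE. Qed.

Lemma bilin_inj G H : (forall u v, bilin G u v = bilin H u v) -> G = H.
Proof. by move=> E; apply/matrixP => i j; rewrite -!bilin_delta. Qed.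

Lemma bilinD G H u v : bilin (G + H) u v = bilin G u v + bilin H u v.
Proof. by rewrite /bilin mulmxDr mulmxDl mxE. Qed.

Lemma bilinN G u v : bilin (- G) u v = - bilin G u v.
Proof. by rewrite /bilin mulmxN mulNmx mxE. Qed.

Lemma bilin_addl G u v w : bilin G (u + v) w = bilin G u w + bilin G v w.
Proof. by rewrite /bilin linearD /= !mulmxDl mxE. Qed.

Lemma bilin_oppl G u v : bilin G (- u) v = - bilin G u v.
Proof. by rewrite /bilin linearN /= !mulNmx mxE. Qed.

Lemma bilin_addr G u v w : bilin G w (u + v) = bilin G w u + bilin G w v.
Proof. by rewrite /bilin mulmxDr mxE. Qed.

Lemma bilin_oppr G u v : bilin G u (- v) = - bilin G u v.
Proof. by rewrite /bilin mulmxN mxE. Qed.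

Lemma bilin_mulmxl G A u v : bilin G (A *m u) v = bilin (A^T *m G) u v.
Proof. by rewrite /bilin trmx_mul !mulmxA. Qed.

Lemma bilin_mulmxr G A u v : bilin G u (A *m v) = bilin (G *m A) u v.
Proof. by rewrite /bilin !mulmxA. Qed.

Lemma bilin_tr G u v : bilin G^T u v = bilin G v u.
Proof.
by rewrite /bilin -[in RHS](trmxK (v^T *m G *m u)) [RHS]mxE !trmx_mul trmxK mulmxA.
Qed.

(** For [G] and [A] the metric and the complex structure, [H] and [B] their derivatives, this gives
    the second clause of [hermitian_1jet]. *)
Lemma bilin_skew_sum G H A B v w :
  B^T *m G + A^T *m H = - (H *m A + G *m B) ->
  bilin H (A *m v) w + bilin H v (A *m w) + bilin G (B *m v) w + bilin G v (B *m w) = 0.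
Proof.
rewrite !bilin_mulmxl !bilin_mulmxr => E.
have := congr1 (fun F => bilin F v w) E; rewrite /= bilinN !bilinD.
by move=> ?; lra.
Qed.
End BilinearForms.

Section Directions.
Variables (R : realType) (V : normedModType R) (p q : nat).
Variables (f : V -> 'M[R]_(p, q)) (x : V).
Hypothesis df : mx_differentiable f x.
Implicit Types u v : V.

Lemma derive_mx_dirB u v : 'D_(u - v) f x = 'D_u f x - 'D_v f x.
Proof. by rewrite -scaleN1r addrC (derive_mx_linear df) scaleN1r addrC. Qed.

Lemma derive_mx_dirN u : 'D_(- u) f x = - 'D_u f x.
Proof. by rewrite -[- u]sub0r derive_mx_dirB derive0 sub0r. Qed.
End Directions.

Lemma derive_bilin (R : realType) (V : normedModType R) n (f : V -> 'M[R]_n) x u v w :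
  mx_differentiable f x ->
  'D_u (fun y => bilin (f y) v w) x = bilin ('D_u f x) v w.
Proof.
move=> df.
have dF : mx_differentiable (fun y => v^T *m f y *m w) x.
  apply: mx_differentiableM; last exact: mx_differentiable_cst.
  by apply: mx_differentiableM => //; exact: mx_differentiable_cst.
rewrite /bilin -derive_mxE//.
rewrite (derive_mulmx _ (mx_differentiableM (mx_differentiable_cst _ _) df)
  (mx_differentiable_cst _ _)).
rewrite derive_cst mulmx0 addr0 (derive_mulmx _ (mx_differentiable_cst _ _) df).
by rewrite derive_cst mul0mx add0r.
Qed.

(* If A conjugates K to a constant S, then D w, the derivative of K, is
   determined by the derivative E w of A, whose symmetry kills the Nijenhuis tensor. *)
Lemma nijenhuis_of_gauge (R : comNzRingType) n (A S K : 'M[R]_n)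
    (D E : 'cV[R]_n -> 'M[R]_n) (u v : 'cV[R]_n) :
  A *m K = S *m A -> (forall w, A *m D w = S *m E w - E w *m K) ->
  (forall w w', E w *m w' = E w' *m w) ->
  A *m (D (K *m u) *m v - D (K *m v) *m u + K *m (D v *m u) - K *m (D u *m v)) = 0.
Proof.
move=> AK AD Es.
have ADz w z : A *m (D w *m z) = S *m (E w *m z) - E w *m (K *m z).
  by rewrite mulmxA AD mulmxBl !mulmxA.
have AKz z : A *m (K *m z) = S *m (A *m z) by rewrite mulmxA AK mulmxA.
rewrite mulmxBr mulmxDr mulmxBr !AKz !ADz (Es (K *m u) v) (Es (K *m v) u).
rewrite (Es (K *m u) (K *m v)) (Es v u) !mulmxBr.
move: (S *m (E v *m (K *m u))) (S *m (E u *m (K *m v))) (E (K *m v) *m (K *m u)) => a b d.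
move: (S *m (S *m (E u *m v))) => e.
by apply/matrixP => i j; rewrite !mxE; ring.
Qed.

(** * First-order jets of a metric and a compatible complex structure in an arbitrary chart *)

Section CompatibleJets.
Variables (R : realType) (m : nat) (M : smooth_manifold R (m + m)).
Variables (g : pseudo_metric M) (K : complex_structure M).
Hypothesis gK : compatible g K.
Variables (c : chart R (m + m) M) (x : 'cV[R]_(m + m)).
Hypotheses (ac : atlas c) (cx : chart_cod c x).
Implicit Types u v w : 'cV[R]_(m + m).

(** These two are the concrete [h] and [k] of [hermitian_1jet]. *)
Definition metric_jet u v w : R := bilin ('D_u (g c) x) v w.
Definition ac_jet u v w : R := bilin (g c x) ('D_u (K c) x *m v) w.

Lemma near_chart_cod : \forall y \near x, chart_cod c y.
Proof. by apply: open_nbhs_nbhs; split=> //; exact: (@chart_cod_open _ _ _ c). Qed.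

Lemma metric_differentiable : mx_differentiable (g c) x.
Proof. exact: mx_smooth_on_differentiable (metric_smooth _ ac) cx. Qed.

Lemma ac_differentiable : mx_differentiable (K c) x.
Proof. exact: mx_smooth_on_differentiable (ac_smooth _ ac) cx. Qed.

Lemma metric_trmx y : chart_cod c y -> (g c y)^T = g c y.
Proof.
move=> cy; apply: bilin_inj => u v; rewrite bilin_tr.
exact: Defs.metric_sym.
Qed.

Lemma ac_mulmxK y v : chart_cod c y -> K c y *m (K c y *m v) = - v.
Proof. by move=> cy; rewrite mulmxA ac_square// mulNmx mul1mx. Qed.

Lemma ac_tr_metric y : chart_cod c y -> (K c y)^T *m g c y = - (g c y *m K c y).
Proof.
move=> cy.
have E : (K c y)^T *m g c y *m K c y = g c y.
  apply: bilin_inj => u v; rewrite -bilin_mulmxr -bilin_mulmxl.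
  exact: gK.
rewrite -[in RHS]E -[in RHS]mulmxA ac_square// mulmxN mulmx1 opprK.
by [].
Qed.

(** In a holomorphic chart around the point the structure is the constant [std_J]. Differentiating
    the conjugation by the Jacobian [A] of the change to that chart brings in the symmetric
    derivative of [A], so [nijenhuis_of_gauge] applies; [A] is then cancelled. *)
Lemma nijenhuis_vanish u v :
  let D w := 'D_w (K c) x in
  D (K c x *m u) *m v - D (K c x *m v) *m u
    + K c x *m (D v *m u) - K c x *m (D u *m v) = 0.
Proof.
move=> D.
have [c' [ac' hc'] c'p] := cs_integrable K (chart_inv c x).
have ox : overlap c c' x by rewrite overlapE; split.
pose A := jacobian_mx c c'.
have dA : mx_differentiable A x by exact: jacobian_mx_differentiable.
have AK w : A x *m D w = std_J R m *m 'D_w A x - 'D_w A x *m K c x.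
  apply/eqP; rewrite eq_sym subr_eq addrC; apply/eqP.
  rewrite -(derive_mulmx _ dA ac_differentiable).
  have -> : std_J R m *m 'D_w A x = 'D_w (fun y => std_J R m *m A y) x.
    rewrite (derive_mulmx _ (mx_differentiable_cst _ _) dA).
    by rewrite derive_cst mul0mx add0r.
  apply: near_eq_derive; apply: filterS (near_overlap ox) => y oy.
  rewrite -(ac_change _ ac ac' oy); congr (_ *m _); apply/esym/hc'.
  exact: overlap_cod (overlap_transition oy).
have B w w' := @derive_jacobian_sym _ _ _ _ _ ac ac' x w w' ox.
have inj w : A x *m w = 0 -> w = 0.
  by move=> /(congr1 (mulmx (jacobian_mx c' c (transition c c' x))));
    rewrite mulmxA jacobian_mxK// mul1mx mulmx0.
apply: inj.
have AKx : A x *m K c x = std_J R m *m A x.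
  rewrite -(ac_change _ ac ac' ox); congr (_ *m _); apply: hc'.
  exact: overlap_cod (overlap_transition ox).
exact: nijenhuis_of_gauge AKx AK B.
Qed.

Lemma ac_jet_leibniz u :
  'D_u (K c) x *m K c x = - (K c x *m 'D_u (K c) x).
Proof.
have dK := ac_differentiable.
apply/eqP; rewrite -addr_eq0 -(derive_mulmx _ dK dK) -(derive_cst (- 1%:M : 'M[R]_(m + m)) x u).
apply/eqP; apply: near_eq_derive; apply: filterS near_chart_cod => y cy.
exact: ac_square.
Qed.

Lemma metric_jet_tr u : ('D_u (g c) x)^T = 'D_u (g c) x.
Proof.
rewrite -(derive_trmx _ metric_differentiable).
apply: near_eq_derive; apply: filterS near_chart_cod => y cy.
exact: metric_trmx.
Qed.

Lemma fundamental_jet u :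
  'D_u (fundamental_form g K c) x
    = ('D_u (K c) x)^T *m g c x + (K c x)^T *m 'D_u (g c) x.
Proof.
have dK := mx_differentiable_tr ac_differentiable.
rewrite (derive_mulmx _ dK metric_differentiable).
by rewrite (derive_trmx _ ac_differentiable).
Qed.

Lemma fundamental_jet_skew u :
  ('D_u (K c) x)^T *m g c x + (K c x)^T *m 'D_u (g c) x
    = - ('D_u (g c) x *m K c x + g c x *m 'D_u (K c) x).
Proof.
rewrite -fundamental_jet -(derive_mulmx _ metric_differentiable ac_differentiable).
have dgK := mx_differentiableM metric_differentiable ac_differentiable.
rewrite -(deriveN (mx_differentiable_derivable dgK)).
apply: near_eq_derive; apply: filterS near_chart_cod => y cy.
exact: ac_tr_metric.
Qed.

Lemma compatible_jet :
  hermitian_1jet (fun v => K c x *m v) metric_jet ac_jet.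
Proof.
have gsym v w : bilin (g c x) v w = bilin (g c x) w v by exact: Defs.metric_sym.
have gKx v w : bilin (g c x) (K c x *m v) w = - bilin (g c x) v (K c x *m w).
  by rewrite bilin_mulmxl ac_tr_metric// bilinN -bilin_mulmxr.
have hsym u v w : metric_jet u v w = metric_jet u w v.
  by rewrite /metric_jet -bilin_tr metric_jet_tr.
split=> // u v w; rewrite /ac_jet.
- rewrite (gsym _ v) [metric_jet u (K c x *m w) v]hsym.
  exact: bilin_skew_sum (fundamental_jet_skew u).
- by rewrite mulmxA ac_jet_leibniz mulNmx bilin_oppl -mulmxA gKx opprK.
- have := congr1 (fun z => bilin (g c x) z w) (nijenhuis_vanish u v).
  rewrite /= !(bilin_addl, bilin_oppl) !gKx.
  have -> : bilin (g c x) 0 w = 0 by rewrite /bilin trmx0 !mul0mx mxE.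
  by move=> *; lra.
Qed.

Lemma ext_d_fundamental u v w :
  ext_d (fundamental_form g K c) x u v w
    = d_fundamental (fun z => K c x *m z) metric_jet ac_jet u v w.
Proof.
have dF : mx_differentiable (fundamental_form g K c) x.
  exact: mx_differentiableM (mx_differentiable_tr ac_differentiable) metric_differentiable.
have E a b d : 'D_a (fun y => bilin (fundamental_form g K c y) b d) x =
    metric_jet a (K c x *m b) d + ac_jet a b d.
  rewrite (derive_bilin _ _ _ dF) fundamental_jet bilinD addrC.
  by rewrite /metric_jet /ac_jet !bilin_mulmxl.
by rewrite /ext_d !E.
Qed.

Lemma metric_jet_odd : odd3 metric_jet.
Proof.
split=> u v w; rewrite /metric_jet ?bilin_oppl ?bilin_oppr//.
by rewrite (derive_mx_dirN metric_differentiable) bilinN.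
Qed.

Lemma metric_jetB u1 u2 v w :
  metric_jet (u1 - u2) v w = metric_jet u1 v w - metric_jet u2 v w.
Proof. by rewrite /metric_jet (derive_mx_dirB metric_differentiable) bilinD bilinN. Qed.

Lemma ac_jet_odd : odd3 ac_jet.
Proof.
split=> u v w; rewrite /ac_jet ?mulmxN ?bilin_oppl ?bilin_oppr//.
by rewrite (derive_mx_dirN ac_differentiable) mulNmx bilin_oppl.
Qed.

Lemma ac_jetB u1 u2 v w :
  ac_jet (u1 - u2) v w = ac_jet u1 v w - ac_jet u2 v w.
Proof.
by rewrite /ac_jet (derive_mx_dirB ac_differentiable) mulmxBl bilin_addl bilin_oppl.
Qed.
End CompatibleJets.

(** * The real bivector [J, K] g^-1 and its tensorial properties *)

Section HitchinBivector.
Variables (R : realType) (m : nat) (M : smooth_manifold R (m + m)).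
Variables (g : pseudo_metric M) (J K : complex_structure M).
Hypotheses (gJ : compatible g J) (gK : compatible g K).
Implicit Types (c : chart R (m + m) M) (x y u v w : 'cV[R]_(m + m)).

(* Written with the adjugate because [invmx] branches on invertibility. *)
Definition metric_inv c y : 'M[R]_(m + m) := (\det (g c y))^-1 *: \adj (g c y).

Definition hitchin_mx c y : 'M[R]_(m + m) := commutator_mx J K c y *m metric_inv c y.

Lemma metric_det c y : atlas c -> chart_cod c y -> \det (g c y) != 0.
Proof.
move=> ac cy; apply/det0P => -[v v0 vg].
move/eqP: v0; apply; apply: trmx_inj; rewrite trmx0.
apply: (@metric_nondegenerate _ _ _ g _ _ ac cy) => w.
rewrite /bilin trmxK.
by rewrite vg mul0mx mxE.
Qed.

Lemma metric_mulV c y : atlas c -> chart_cod c y -> g c y *m metric_inv c y = 1%:M.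
Proof.
move=> ac cy; rewrite /metric_inv -scalemxAr mul_mx_adj.
by rewrite scale_scalar_mx mulVf// metric_det.
Qed.

(** Identities for [hitchin_mx] are checked after multiplication by the metric, which turns it into
    the commutator. *)
Lemma metric_mul_inj c y (A B : 'M[R]_(m + m)) : atlas c -> chart_cod c y ->
  A *m g c y = B *m g c y -> A = B.
Proof.
move=> ac cy /(congr1 (mulmx^~ (metric_inv c y))).
by rewrite -!mulmxA metric_mulV// !mulmx1.
Qed.

Lemma hitchin_mul_metric c y : atlas c -> chart_cod c y ->
  hitchin_mx c y *m g c y = commutator_mx J K c y.
Proof.
by move=> ac cy; rewrite -mulmxA (mulmx1C (metric_mulV ac cy)) mulmx1.
Qed.

(** [J] and [K] are skew for g, and so is the commutator of two skew endomorphisms. *)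
Lemma commutator_tr_metric c y : atlas c -> chart_cod c y ->
  (commutator_mx J K c y)^T *m g c y = - (g c y *m commutator_mx J K c y).
Proof.
move=> ac cy; have EJ := ac_tr_metric gJ ac cy; have EK := ac_tr_metric gK ac cy.
rewrite /commutator_mx linearB /= !trmx_mul mulmxBl -!mulmxA EJ EK !mulmxN.
by rewrite !mulmxA EJ EK !mulNmx !opprK mulmxBr !mulmxA opprB.
Qed.

Lemma hitchin_mx_tr c y : atlas c -> chart_cod c y ->
  (hitchin_mx c y)^T = - hitchin_mx c y.
Proof.
move=> ac cy; apply: (metric_mul_inj ac cy).
have gi : injective (mulmx (g c y) : 'M[R]_(m + m) -> _).
  by apply: can_inj (mulmx (metric_inv c y)) _ => A;
     rewrite mulmxA (mulmx1C (metric_mulV ac cy)) mul1mx.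
apply: gi; rewrite mulNmx hitchin_mul_metric// mulmxN -commutator_tr_metric//.
by rewrite -(hitchin_mul_metric ac cy) [in RHS]trmx_mul (metric_trmx g ac cy) mulmxA.
Qed.

(** The commutator anticommutes with [J] and [J] is skew for g, so the two signs cancel. The
    equation says that the bivector has no (1,1) part for [J]. *)
Lemma hitchin_mx_type c y : atlas c -> chart_cod c y ->
  J c y *m hitchin_mx c y = hitchin_mx c y *m (J c y)^T.
Proof.
move=> ac cy; apply: (metric_mul_inj ac cy).
rewrite -mulmxA hitchin_mul_metric// -mulmxA ac_tr_metric// mulmxN mulmxA.
rewrite hitchin_mul_metric// /commutator_mx mulmxBr mulmxBl !mulmxA.
by rewrite ac_square// -[K c y *m J c y *m J c y]mulmxA ac_square// mulmxN mulNmx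
  mul1mx mulmx1 opprB.
Qed.

Lemma commutator_change c c' x : atlas c -> atlas c' -> overlap c c' x ->
  commutator_mx J K c' (transition c c' x) *m jacobian_mx c c' x
    = jacobian_mx c c' x *m commutator_mx J K c x.
Proof.
move=> ac ac' cx; have EJ := ac_change J ac ac' cx; have EK := ac_change K ac ac' cx.
by rewrite /commutator_mx mulmxBl -!mulmxA EJ EK !mulmxA EJ EK mulmxBr !mulmxA.
Qed.

Lemma hitchin_mx_change c c' x : atlas c -> atlas c' -> overlap c c' x ->
  hitchin_mx c' (transition c c' x)
    = jacobian_mx c c' x *m hitchin_mx c x *m (jacobian_mx c c' x)^T.
Proof.
move=> ac ac' ox; have cx := overlap_cod ox.
have cx' := overlap_cod (overlap_transition ox).
apply: (metric_mul_inj ac' cx'); rewrite hitchin_mul_metric//.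
have AA := mulmx1C (jacobian_mxK ac ac' ox).
rewrite -[LHS]mulmx1 -[RHS]mulmx1 -AA !(mulmxA _ (jacobian_mx c c' x)).
congr (_ *m _); rewrite commutator_change// -hitchin_mul_metric//.
by rewrite (metric_change g ac ac' ox) !mulmxA.
Qed.

Lemma hitchin_mx_differentiable c x : atlas c -> chart_cod c x ->
  mx_differentiable (hitchin_mx c) x.
Proof.
move=> ac cx; apply: mx_differentiableM.
  by apply: mx_differentiableB; apply: mx_differentiableM; exact: ac_differentiable.
by apply: mx_differentiable_det_adj; [exact: metric_differentiable|exact: metric_det].
Qed.
End HitchinBivector.

(** * Derivatives of the bivector in a holomorphic chart of J *)

Section HitchinDerivative.
Variables (R : realType) (m : nat) (M : smooth_manifold R (m + m)).
Variables (g : pseudo_metric M) (J K : complex_structure M).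
Hypotheses (gJ : compatible g J) (gK : compatible g K).
Variables (c : chart R (m + m) M) (x : 'cV[R]_(m + m)).
Hypotheses (hc : holo_chart J c) (cx : chart_cod c x).
Hypothesis dF : forall u v w : 'cV[R]_(m + m),
  twisted_d (J c) (fundamental_form g J c) x u v w
    = - twisted_d (K c) (fundamental_form g K c) x u v w.
Implicit Types (u v w a b : 'cV[R]_(m + m)).

Let ac : atlas c. Proof. by case: hc. Qed.
Let G := g c x.
Let Q := hitchin_mx g J K c.
Let dQ : mx_differentiable Q x. Proof. exact: hitchin_mx_differentiable. Qed.
Let h := metric_jet g c x.
Let k := ac_jet g K c x.

Lemma derive_holo_chart u : 'D_u (J c) x = 0.
Proof.
rewrite -(derive_cst (std_J R m : 'M[R]_(m + m)) x u); apply: near_eq_derive.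
by apply: filterS (near_chart_cod cx) => y; case: hc => _; exact.
Qed.

(** Differentiating the equation [Q] g = [J, K] rather than [Q] itself keeps the derivative of the
    inverse metric out; [J] contributes nothing, being constant in the chart. *)
Lemma derive_hitchin_mx u a b :
  bilin ('D_u Q x) (G *m b) (G *m a)
    = hitchin_deriv (fun v => J c x *m v) (fun v => K c x *m v) h k u a b.
Proof.
have dg := metric_differentiable g ac cx.
have dJ := ac_differentiable J ac cx; have dK := ac_differentiable K ac cx.
have gtr : G^T = G := metric_trmx g ac cx.
have gsym v w : bilin G v w = bilin G w v by rewrite -[in LHS]gtr bilin_tr.
have E : 'D_u Q x *m G = J c x *m 'D_u (K c) x - 'D_u (K c) x *m J c x - Q x *m 'D_u (g c) x.
  apply/eqP; rewrite eq_sym subr_eq eq_sym; apply/eqP.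
  rewrite -(derive_mulmx _ dQ dg).
  transitivity ('D_u (commutator_mx J K c) x).
    apply: near_eq_derive; apply: filterS (near_chart_cod cx) => y cy.
    exact: hitchin_mul_metric.
  rewrite (derive_mxB _ (mx_differentiableM dJ dK) (mx_differentiableM dK dJ)).
  rewrite (derive_mulmx _ dJ dK) (derive_mulmx _ dK dJ).
  by rewrite derive_holo_chart mul0mx mulmx0 add0r addr0.
have gJx v w : bilin G (J c x *m v) w = - bilin G v (J c x *m w).
  by rewrite bilin_mulmxl (ac_tr_metric gJ ac cx) bilinN -bilin_mulmxr.
rewrite bilin_mulmxr E bilin_mulmxl gtr.
have GQ : G *m Q x = - (commutator_mx J K c x)^T.
  rewrite -(hitchin_mul_metric g J K ac cx) [in RHS]trmx_mul -/G gtr.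
  by rewrite (hitchin_mx_tr gJ gK ac cx) mulmxN opprK.
have GB (A B H : 'M[R]_(m + m)) : G *m (A - B - Q x *m H) =
    G *m A - G *m B + (commutator_mx J K c x)^T *m H.
  by rewrite 2!mulmxBr [G *m (Q x *m H)]mulmxA GQ mulNmx opprK.
rewrite GB !(bilinD, bilinN) -bilin_mulmxl mulmxA.
have -> : bilin (G *m J c x *m 'D_u (K c) x) b a = - k u a (J c x *m b).
  by rewrite -!bilin_mulmxr gsym gJx.
have -> : bilin (G *m ('D_u (K c) x *m J c x)) b a = k u (J c x *m a) b.
  by rewrite mulmxA -!bilin_mulmxr gsym.
have hsym v w : bilin ('D_u (g c) x) v w = h u w v.
  by rewrite -bilin_tr (metric_jet_tr g ac cx).
rewrite hsym /hitchin_deriv /commutator_mx mulmxBl.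
rewrite /h /metric_jet bilin_addr bilin_oppr !mulmxA.
by move=> *; lra.
Qed.

(** Every covector is a lowered vector, so identities for [Q] may be tested on covectors [G *m a],
    as in [hitchin_deriv]. *)
Lemma metric_mul_surj v : exists a, v = G *m a.
Proof.
by exists (metric_inv g c x *m v); rewrite mulmxA (metric_mulV g ac cx) mul1mx.
Qed.

Let jetJ : hermitian_1jet (fun v => J c x *m v) h (fun _ _ _ => 0).
Proof.
have := compatible_jet gJ ac cx.
congr hermitian_1jet; apply/funext => u; apply/funext => v; apply/funext => w.
by rewrite /ac_jet derive_holo_chart mul0mx /bilin trmx0 !mul0mx mxE.
Qed.

Let H u v w := d_fundamental (fun z => K c x *m z) h k (K c x *m u) (K c x *m v) (K c x *m w).

Let HJ u v w : H u v w
  = - d_fundamental (fun z => J c x *m z) h (fun _ _ _ => 0)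
        (J c x *m u) (J c x *m v) (J c x *m w).
Proof.
have := dF u v w; rewrite /twisted_d !ext_d_fundamental//.
have -> : ac_jet g J c x = fun _ _ _ => 0.
  apply/funext => a; apply/funext => b; apply/funext => d.
  by rewrite /ac_jet derive_holo_chart mul0mx /bilin trmx0 !mul0mx mxE.
by rewrite opprK.
Qed.

Let Jopp u : J c x *m (- u) = - (J c x *m u). Proof. exact: mulmxN. Qed.
Let Kopp u : K c x *m (- u) = - (K c x *m u). Proof. exact: mulmxN. Qed.
Let JJ u : J c x *m (J c x *m u) = - u. Proof. exact: ac_mulmxK. Qed.
Let KK u : K c x *m (K c x *m u) = - u. Proof. exact: ac_mulmxK. Qed.
Let h_odd : odd3 h. Proof. exact: metric_jet_odd. Qed.
Let k_odd : odd3 k. Proof. exact: ac_jet_odd. Qed.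
Let jetK : hermitian_1jet (fun v => K c x *m v) h k. Proof. exact: compatible_jet. Qed.
Let HK u v w : H u v w = d_fundamental (fun z => K c x *m z) h k
  (K c x *m u) (K c x *m v) (K c x *m w).
Proof. by []. Qed.

Lemma hitchin_mx_holomorphic u :
  'D_(J c x *m u) Q x = 'D_u Q x *m (J c x)^T.
Proof.
apply: bilin_inj => v w; have [b ->] := metric_mul_surj v; have [a ->] := metric_mul_surj w.
have E : (J c x)^T *m (G *m a) = - (G *m (J c x *m a)).
  by rewrite mulmxA (ac_tr_metric gJ ac cx) mulNmx mulmxA.
have RHSE : bilin ('D_u Q x *m (J c x)^T) (G *m b) (G *m a)
    = - bilin ('D_u Q x) (G *m b) (G *m (J c x *m a)).
  by rewrite -bilin_mulmxr E bilin_oppr.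
apply: etrans (derive_hitchin_mx _ _ _) (etrans _ (esym RHSE)).
rewrite derive_hitchin_mx.
exact: (hitchin_deriv_holomorphic Jopp JJ Kopp KK h_odd k_odd jetJ jetK HJ HK).
Qed.

Lemma hitchin_mx_jacobi u v w :
  bilin ('D_(Q x *m u) Q x) v w + bilin ('D_(Q x *m v) Q x) w u
    + bilin ('D_(Q x *m w) Q x) u v = 0.
Proof.
have [a ->] := metric_mul_surj u; have [b ->] := metric_mul_surj v.
have [d ->] := metric_mul_surj w.
have QG z : Q x *m (G *m z) = J c x *m (K c x *m z) - K c x *m (J c x *m z).
  by rewrite mulmxA (hitchin_mul_metric g J K ac cx) mulmxBl -!mulmxA.
rewrite !QG.
apply: etrans (f_equal2 +%R (f_equal2 +%R (derive_hitchin_mx _ _ _) (derive_hitchin_mx _ _ _))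
  (derive_hitchin_mx _ _ _)) _.
(* [derive_hitchin_mx] reverses its two covectors, so this is the Jacobi sum of the triple [a], [d],
   [b]. *)
rewrite addrAC.
apply: (hitchin_deriv_jacobi Jopp JJ Kopp KK h_odd k_odd _ _ jetJ jetK HJ HK).
- exact: metric_jetB.
- exact: ac_jetB.
Qed.
End HitchinDerivative.

(** * Complex matrices as pairs of real ones *)

Section ComplexMatrices.
Variable R : realType.

Lemma sum_complex (I : finType) (F G : I -> R) :
  \sum_i (F i +i* G i)%C = ((\sum_i F i) +i* (\sum_i G i))%C.
Proof.
elim/big_rec3 : _ => [//|i a b d _ ->].
by apply/eqP; rewrite eq_complex /= !eqxx.
Qed.

Definition complex_mx p q (A B : 'M[R]_(p, q)) : 'M[R[i]]_(p, q) :=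
  \matrix_(i, j) (A i j +i* B i j)%C.

Lemma complex_mx_mul p q r (A B : 'M[R]_(p, q)) (C D : 'M[R]_(q, r)) :
  complex_mx A B *m complex_mx C D
    = complex_mx (A *m C - B *m D) (A *m D + B *m C).
Proof.
apply/matrixP => i j; rewrite !mxE -sumrB -big_split -sum_complex /=.
by apply: eq_bigr => k _; rewrite !mxE.
Qed.

Lemma complex_mx_tr p q (A B : 'M[R]_(p, q)) :
  (complex_mx A B)^T = complex_mx A^T B^T.
Proof. by apply/matrixP => i j; rewrite !mxE. Qed.

Lemma complex_mx0 p q (A B : 'M[R]_(p, q)) :
  complex_mx A B = 0 -> A = 0 /\ B = 0.
Proof.
move=> /matrixP AB; split; apply/matrixP => i j;
  by have := AB i j; rewrite !mxE => /eqP; rewrite eq_complex /= => /andP[/eqP ? /eqP ?].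
Qed.

Lemma halfD (z : R[i]) : (z + z) / 2%:R = z.
Proof. by rewrite -mulr2n -[z *+ 2]mulr_natr mulfK// pnatr_eq0. Qed.
End ComplexMatrices.

(** * The standard complex structure and the Cauchy-Riemann equations *)

Section StandardStructure.
Variables (R : realType) (m : nat).
Implicit Types (A Q : 'M[R]_(m + m)).

(** The block form is that of a complex linear map P + iN, with P and N the left blocks. *)
Lemma std_J_commute A : std_J R m *m A = A *m std_J R m ->
  A = block_mx (ulsubmx A) (- dlsubmx A) (dlsubmx A) (ulsubmx A).
Proof.
rewrite -{1 2}[A]submxK /std_J !mulmx_block.
rewrite !(mul0mx, mulmx0, mul1mx, mulmx1, mulNmx, mulmxN, add0r, addr0).
move/eq_block_mx => [E1 E2 _ _]; rewrite -[LHS]submxK.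
by rewrite -E1 (oppr_inj E2).
Qed.

Lemma std_J_tr : (std_J R m)^T = - std_J R m.
Proof.
by rewrite /std_J tr_block_mx opp_block_mx trmx0 linearN /= trmx1 oppr0 opprK.
Qed.

(** Such a contravariant tensor is determined by its upper blocks, which become the real and
    imaginary parts of a complex matrix in [hitchin_biv]. *)
Lemma std_J_type Q : std_J R m *m Q = Q *m (std_J R m)^T ->
  Q = block_mx (ulsubmx Q) (ursubmx Q) (ursubmx Q) (- ulsubmx Q).
Proof.
rewrite std_J_tr -{1 2}[Q]submxK /std_J opp_block_mx opprK !oppr0 !mulmx_block.
rewrite !(mul0mx, mulmx0, mul1mx, mulmx1, mulNmx, mulmxN, add0r, addr0).
move/eq_block_mx => [E1 E2 E3 E4].
by rewrite -[LHS]submxK -E4 E3 opprK.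
Qed.

Lemma std_J_delta (k : 'I_m) :
  std_J R m *m delta_mx (lshift m k) 0 = delta_mx (rshift m k) 0 :> 'cV[R]_(m + m).
Proof.
apply/matrixP => i j; rewrite -colE mxE /std_J.
case: (split_ordP i) => i' ->; rewrite ?block_mxEul ?block_mxEdl !mxE (ord1 j) andbT.
  by rewrite eq_lrshift.
by rewrite eq_rshift.
Qed.

(* The first two hypotheses on the partial derivatives are the Cauchy-Riemann
   equations of [p + i s]. *)
Lemma cauchy_riemann (f : 'cV[R]_(m + m) -> R[i]) (p s : 'cV[R]_(m + m) -> R) k x :
  (forall y, f y = (p y +i* s y)%C) ->
  partial (rshift m k) p x = - partial (lshift m k) s x ->
  partial (rshift m k) s x = partial (lshift m k) p x ->
  dz k f x = (partial (lshift m k) p x +i* partial (lshift m k) s x)%C /\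
  dzbar k f x = 0.
Proof.
move=> fE cr1 cr2; rewrite (funext fE) /dz /dzbar /cpartial /= cr1 cr2.
set u := partial _ p x; set v := partial _ s x.
have -> : 'i%C * (- v +i* u)%C = - (u +i* v)%C.
  by apply/eqP; rewrite eq_complex /=; apply/andP; split; apply/eqP; ring.
by rewrite opprK subrr mul0r halfD.
Qed.
End StandardStructure.

Section StandardEntries.
Variables (R : realType) (m : nat).

Lemma std_J_sqr : std_J R m *m std_J R m = - 1%:M.
Proof.
rewrite /std_J mulmx_block !(mul0mx, mulmx0, mul1mx, mulmx1, mulNmx, add0r, addr0).
by rewrite [in RHS]scalar_mx_block opp_block_mx oppr0.
Qed.

Lemma mul_std_JT_l p (A : 'M[R]_(p, m + m)) i b :
  (A *m (std_J R m)^T) i (lshift m b) = - A i (rshift m b).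
Proof.
transitivity ((A *m (std_J R m)^T *m (delta_mx (lshift m b) 0 : 'cV_(m + m))) i 0).
  by rewrite -colE [RHS]mxE.
rewrite -mulmxA std_J_tr mulNmx std_J_delta mulmxN mxE.
by rewrite -colE mxE.
Qed.

Lemma mul_std_JT_r p (A : 'M[R]_(p, m + m)) i b :
  (A *m (std_J R m)^T) i (rshift m b) = A i (lshift m b).
Proof.
transitivity ((A *m (std_J R m)^T *m (delta_mx (rshift m b) 0 : 'cV_(m + m))) i 0).
  by rewrite -colE [RHS]mxE.
rewrite -mulmxA std_J_tr mulNmx -std_J_delta mulmxA std_J_sqr mulNmx mul1mx opprK.
by rewrite -colE mxE.
Qed.

(** Passing from real to complex components commutes with changes of holomorphic coordinates. *)
Lemma complex_mx_congr (P N X Y : 'M[R]_m) :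
  let A := block_mx P (- N) N P in
  let B := A *m block_mx X Y Y (- X) *m A^T in
  complex_mx (ulsubmx B) (ursubmx B)
    = complex_mx P N *m complex_mx X Y *m (complex_mx P N)^T.
Proof.
have trN (E : 'M[R]_m) : (- E)^T = - E^T by exact: linearN.
move=> A B; rewrite /B /A complex_mx_tr !complex_mx_mul tr_block_mx trN !mulmx_block.
rewrite block_mxKul block_mxKur !mulmxN !mulNmx opprK.
by [].
Qed.
End StandardEntries.

(** * The holomorphic Poisson bivector *)

Section HolomorphicBivector.
Variables (R : realType) (m : nat) (M : smooth_manifold R (m + m)).
Variables (g : pseudo_metric M) (J K : complex_structure M).
Hypotheses (gJ : compatible g J) (gK : compatible g K).
Hypothesis dF : forall (c : chart R (m + m) M) (x : 'cV[R]_(m + m)),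
  atlas c -> chart_cod c x ->
  forall u v w : 'cV[R]_(m + m),
  twisted_d (J c) (fundamental_form g J c) x u v w
    = - twisted_d (K c) (fundamental_form g K c) x u v w.
Implicit Types (c : chart R (m + m) M) (x : 'cV[R]_(m + m)).

Let Q := hitchin_mx g J K.

(** As d/dz_a is half of d/dx_a - i d/dy_a, the bivector with these components has a quarter of [Q]
    as its real part. *)
Definition hitchin_biv c x : 'M[R[i]]_m :=
  complex_mx (ulsubmx (Q c x)) (ursubmx (Q c x)).

Lemma hitchin_bivE c x a b : hitchin_biv c x a b =
  (Q c x (lshift m a) (lshift m b) +i* Q c x (lshift m a) (rshift m b))%C.
Proof. by rewrite !mxE. Qed.

Lemma hitchin_mx_block c x : holo_chart J c -> chart_cod c x -> Q c x =
  block_mx (ulsubmx (Q c x)) (ursubmx (Q c x)) (ursubmx (Q c x)) (- ulsubmx (Q c x)).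
Proof. by move=> [ac Jc] cx; apply: std_J_type; rewrite -(Jc x cx); exact: hitchin_mx_type. Qed.

Lemma hitchin_mx_rl c x a b : holo_chart J c -> chart_cod c x ->
  Q c x (rshift m a) (lshift m b) = Q c x (lshift m a) (rshift m b).
Proof. by move=> hc cx; rewrite (hitchin_mx_block hc cx) block_mxEdl block_mxEur. Qed.

Lemma hitchin_mx_rr c x a b : holo_chart J c -> chart_cod c x ->
  Q c x (rshift m a) (rshift m b) = - Q c x (lshift m a) (lshift m b).
Proof.
by move=> hc cx; rewrite (hitchin_mx_block hc cx) block_mxEdr block_mxEul mxE.
Qed.

Section AtPoint.
Variables (c : chart R (m + m) M) (x : 'cV[R]_(m + m)).
Hypotheses (hc : holo_chart J c) (cx : chart_cod c x).

Let ac : atlas c. Proof. by case: hc. Qed.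
Let Jx : J c x = std_J R m. Proof. by case: hc => _; exact. Qed.
Let dQ : mx_differentiable (Q c) x. Proof. exact: hitchin_mx_differentiable. Qed.

Lemma hitchin_mx_skew i j : Q c x j i = - Q c x i j.
Proof.
have := congr1 (fun A : 'M[R]_(m + m) => A i j) (hitchin_mx_tr gJ gK ac cx).
by rewrite /= mxE [RHS]mxE.
Qed.

Lemma hitchin_biv_skew : (hitchin_biv c x)^T = - hitchin_biv c x.
Proof.
apply/matrixP => a b; rewrite mxE [RHS]mxE !hitchin_bivE.
rewrite hitchin_mx_skew (hitchin_mx_skew (rshift m a)) (hitchin_mx_rl _ _ hc cx).
by apply/eqP; rewrite eq_complex /= !eqxx.
Qed.

Lemma partial_hitchin_mx k i j :
  partial k (fun y => Q c y i j) x = ('D_(delta_mx k 0) (Q c) x) i j.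
Proof. by rewrite derive_mxE. Qed.

(** [std_J] sends d/dx_k to d/dy_k, so [hitchin_mx_holomorphic] relates the two partial
    derivatives. *)
Lemma derive_hitchin_rshift k :
  'D_(delta_mx (rshift m k) 0) (Q c) x
    = 'D_(delta_mx (lshift m k) 0) (Q c) x *m (std_J R m)^T.
Proof.
rewrite -std_J_delta -{1}Jx -[in RHS]Jx.
exact: (hitchin_mx_holomorphic gJ gK hc cx (dF ac cx)).
Qed.

Lemma partial_hitchin_rl k i b :
  partial (rshift m k) (fun y => Q c y i (lshift m b)) x
    = - partial (lshift m k) (fun y => Q c y i (rshift m b)) x.
Proof. by rewrite !partial_hitchin_mx derive_hitchin_rshift mul_std_JT_l. Qed.

Lemma partial_hitchin_rr k i b :
  partial (rshift m k) (fun y => Q c y i (rshift m b)) x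
    = partial (lshift m k) (fun y => Q c y i (lshift m b)) x.
Proof. by rewrite !partial_hitchin_mx derive_hitchin_rshift mul_std_JT_r. Qed.

Lemma dz_hitchin_biv k a b :
  dz k (fun y => hitchin_biv c y a b) x =
    (partial (lshift m k) (fun y => Q c y (lshift m a) (lshift m b)) x +i*
     partial (lshift m k) (fun y => Q c y (lshift m a) (rshift m b)) x)%C /\
  dzbar k (fun y => hitchin_biv c y a b) x = 0.
Proof.
apply: cauchy_riemann => [y||]; first exact: hitchin_bivE.
- exact: partial_hitchin_rl.
- exact: partial_hitchin_rr.
Qed.

Let B i j k := bilin ('D_(Q c x *m delta_mx i 0) (Q c) x) (delta_mx j 0) (delta_mx k 0).

Lemma derive_along_hitchin i j k : B i j k =
  \sum_l partial (lshift m l) (fun y => Q c y j k) x * Q c x (lshift m l) i +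
  \sum_l partial (rshift m l) (fun y => Q c y j k) x * Q c x (rshift m l) i.
Proof.
rewrite /B bilin_delta derive_mxE// derive_partial; last exact: dQ.
by rewrite big_split_ord /=; congr (_ + _); apply: eq_bigr => l _; rewrite -colE mxE.
Qed.

Lemma hitchin_biv_term i j k :
  \sum_l hitchin_biv c x l i * dz l (fun y => hitchin_biv c y j k) x =
  (B (lshift m i) (lshift m j) (lshift m k) +i*
   B (lshift m i) (lshift m j) (rshift m k))%C.
Proof.
rewrite !derive_along_hitchin -!big_split -sum_complex /=; apply: eq_bigr => l _.
rewrite (dz_hitchin_biv l j k).1 hitchin_bivE.
rewrite !partial_hitchin_rl !partial_hitchin_rr !(hitchin_mx_rl _ _ hc cx).
by apply/eqP; rewrite eq_complex /=; apply/andP; split; apply/eqP; ring.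
Qed.

Lemma derive_along_rl i j k :
  B i (rshift m j) (lshift m k) = B i (lshift m j) (rshift m k).
Proof.
rewrite /B !bilin_delta !derive_mxE//; apply: near_eq_derive.
by apply: filterS (near_chart_cod cx) => y cy; exact: hitchin_mx_rl.
Qed.

(** With [derive_along_rl], this moves the only y-index of a real Jacobi term to the last slot,
    where [hitchin_biv_term] has its imaginary part. *)
Lemma derive_along_rll i j k :
  B (rshift m i) (lshift m j) (lshift m k) = B (lshift m i) (lshift m j) (rshift m k).
Proof.
rewrite !derive_along_hitchin -!big_split /=; apply: eq_bigr => l _.
rewrite !partial_hitchin_rl !partial_hitchin_rr !(hitchin_mx_rl _ _ hc cx).
rewrite !(hitchin_mx_rr _ _ hc cx); ring.
Qed.

Lemma schouten_hitchin_biv i j k :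
  schouten (hitchin_biv c) (hitchin_biv c) x i j k = 0.
Proof.
have jac a b d : B a b d + B b d a + B d a b = 0.
  exact: (hitchin_mx_jacobi gJ gK hc cx (dF ac cx)).
have term a b d :
    \sum_l (hitchin_biv c x l a * dz l (fun y => hitchin_biv c y b d) x +
            hitchin_biv c x l a * dz l (fun y => hitchin_biv c y b d) x) =
    ((B (lshift m a) (lshift m b) (lshift m d) *+ 2) +i*
     (B (lshift m a) (lshift m b) (rshift m d) *+ 2))%C.
  by rewrite big_split /= hitchin_biv_term; apply/eqP; rewrite eq_complex /= !mulr2n !eqxx.
rewrite /schouten (term i j k) (term j k i) (term k i j).
(* The real part of the bracket is twice the real Jacobi sum at three x-indices; the imaginary part
   is twice the one whose last index is a y-index. *)
have E1 := jac (lshift m i) (lshift m j) (lshift m k).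
have E2 := jac (lshift m i) (lshift m j) (rshift m k).
rewrite derive_along_rl derive_along_rll in E2.
apply/eqP; rewrite eq_complex /=; apply/andP; split; apply/eqP.
- by move: E1; move=> *; lra.
- by move: E2; move=> *; lra.
Qed.

End AtPoint.

(** Between holomorphic charts the real Jacobian commutes with [std_J]; its block form is the
    Cauchy-Riemann system of the transition map. *)
Lemma cjacobian_mxE c c' x : holo_chart J c -> holo_chart J c' -> overlap c c' x ->
  let A := jacobian_mx c c' x in
  A = block_mx (ulsubmx A) (- dlsubmx A) (dlsubmx A) (ulsubmx A) /\
  cjacobian_mx c c' x = complex_mx (ulsubmx A) (dlsubmx A).
Proof.
move=> [ac Jc] [ac' Jc'] ox A.
have AJ : A = block_mx (ulsubmx A) (- dlsubmx A) (dlsubmx A) (ulsubmx A).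
  apply: std_J_commute; have := ac_change J ac ac' ox.
  by rewrite (Jc x (overlap_cod ox)) (Jc' _ (overlap_cod (overlap_transition ox))).
split=> //; apply/matrixP => a b; rewrite [LHS]mxE [RHS]mxE.
have AE i j : A i j = partial j (fun y => transition c c' y i 0) x by rewrite mxE.
have [||| -> _] // := @cauchy_riemann _ _ (fun y => zcoord a (transition c c' y))
  (fun y => transition c c' y (lshift m a) 0)
  (fun y => transition c c' y (rshift m a) 0) b x.
- by rewrite -!AE AJ block_mxEur block_mxEdl mxE.
- by rewrite -!AE AJ block_mxEul block_mxEdr.
- by rewrite -!AE !mxE.
Qed.

Lemma hitchin_biv_change c c' : holo_chart J c -> holo_chart J c' ->
  forall x, overlap c c' x ->
  hitchin_biv c' (transition c c' x)
    = cjacobian_mx c c' x *m hitchin_biv c x *m (cjacobian_mx c c' x)^T.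
Proof.
move=> hc hc' x ox; have [AE ->] := cjacobian_mxE hc hc' ox.
have [ac _] := hc; have [ac' _] := hc'.
rewrite /hitchin_biv -complex_mx_congr /= -AE -hitchin_mx_block//; last exact: overlap_cod ox.
by rewrite -hitchin_mx_change.
Qed.

(** Kept transparent, so that its components compute to [hitchin_biv] in the proofs below. *)
Definition hitchin_bivector : holomorphic_bivector J.
Proof.
refine (@HolomorphicBivector _ _ _ J hitchin_biv hitchin_biv_skew _ hitchin_biv_change).
move=> c hc a b x cx; have [ac _] := hc.
have dQ : mx_differentiable (Q c) x by exact: hitchin_mx_differentiable.
split.
- by under eq_fun do rewrite hitchin_bivE /=; exact: dQ.
- by under eq_fun do rewrite hitchin_bivE /=; exact: dQ.
- by move=> k; have [] := dz_hitchin_biv hc cx k a b.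
Defined.

Lemma hitchin_bivector_vanishes p :
  vanishes_at hitchin_bivector p <->
  (forall c, atlas c -> chart_dom c p -> commutator_mx J K c (chart_map c p) = 0).
Proof.
split=> [van c ac cp|com c [ac _] cp].
- have [c' hc' c'p] := cs_integrable J p.
  have [ac' _] := hc'.
  have codp : chart_cod c' (chart_map c' p) by exists p.
  have [X0 Y0] := complex_mx0 (van c' hc' c'p).
  have Q0 : Q c' (chart_map c' p) = 0.
    rewrite (hitchin_mx_block hc' codp) X0 Y0 oppr0.
    exact: block_mx0.
  have S0 : commutator_mx J K c' (chart_map c' p) = 0.
    by rewrite -(hitchin_mul_metric g J K ac' codp) -/Q Q0 mul0mx.
  (* Vanishing is known in holomorphic charts only; [commutator_change] and an invertible Jacobian
     carry it to the arbitrary chart [c]. *)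
  have ox : overlap c' c (chart_map c' p) by exists p.
  have := commutator_change J K ac' ac ox.
  rewrite S0 mulmx0 /transition chart_mapK//.
  move=> /(congr1 (mulmx^~ (jacobian_mx c c' (chart_map c p)))).
  have := jacobian_mxK ac' ac ox; rewrite /transition chart_mapK// => /mulmx1C AA.
  by rewrite -mulmxA AA mulmx1 mul0mx.
- rewrite /= /hitchin_biv /Q /hitchin_mx com// mul0mx.
  by apply/matrixP => i j; rewrite !mxE.
Qed.
End HolomorphicBivector.

Theorem theorem3 (R : realType) (m : nat) (M : smooth_manifold R (m + m))
    (g : pseudo_metric M) (Jp Jm : complex_structure M)
    (Jp_compatible : compatible g Jp)
    (Jm_compatible : compatible g Jm)
    (dF_opp : forall (c : chart R (m + m) M) (x : 'cV[R]_(m + m)),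
       atlas c -> chart_cod c x ->
       forall u v w : 'cV[R]_(m + m),
       twisted_d (Jp c) (fundamental_form g Jp c) x u v w
         = - twisted_d (Jm c) (fundamental_form g Jm c) x u v w) :
  exists Pi : holomorphic_bivector Jp,
    is_poisson Pi /\
    (forall p : M,
       vanishes_at Pi p <->
       (forall c : chart R (m + m) M, atlas c -> chart_dom c p ->
          commutator_mx Jp Jm c (chart_map c p) = 0)).
Proof.
exists (hitchin_bivector Jp_compatible Jm_compatible dF_opp); split.
  by move=> c x hc cx i j k; exact: schouten_hitchin_biv.
exact: hitchin_bivector_vanishes.
Qed.
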